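(* There is an absolute constant $c$ such that for all finite groups $G$ and $H$ of order $n$ and all integers $k \geq 2$, $r \geq 1$: (a) if $(k,r)$-WL Version I distinguishes $G$ and $H$, then $(k,r)$-WL Version II distinguishes $G$ and $H$; (b) if $(k,r)$-WL Version II distinguishes $G$ and $H$, then $(\lceil k/2\rceil + 2,\ 3r + c\log n)$-WL Version III distinguishes $G$ and $H$; (c) if $(k,r)$-WL Version III distinguishes $G$ and $H$, then $(2k+1, 2r)$-WL Version I distinguishes $G$ and $H$.
   Context: All three versions color $k$-tuples and refine by $\chi_{t+1}(\bar v) = (\chi_t(\bar v), \{\!\{(\chi_t(\bar v(v_1/x)),\dots,\chi_t(\bar v(v_k/x))) : x\}\!\})$, where $x$ ranges over the underlying set, $\bar v(v_i/x)$ replaces the $i$-th entry by $x$, and $\{\!\{\cdot\}\!\}$ denotes a multiset; $(k,r)$-WL runs $r$ rounds, the initial coloring counting as the first, and distinguishes two structures if their sizes differ or the multisets of colors of their $k$-tuples after $r$ rounds differ. Version I (on $G^k$): $(g_1,\dots,g_k),(h_1,\dots,h_k)$ get the same initial color iff for all $i,j,\ell$, $g_ig_j = g_\ell \iff h_ih_j = h_\ell$, and $g_i = g_j \iff h_i = h_j$. Version II (on $G^k$): same initial color iff $g_i \mapsto h_i$ extends to an isomorphism $\langle g_1,\dots,g_k\rangle\to\langle h_1,\dots,h_k\rangle$. Version III: build the graph $\Gamma_G$ whose vertices are the elements of $G$ together with, for each $(g,h)\in G^2$, four new vertices $a_{gh},b_{gh},c_{gh},d_{gh}$ with edges $\{g,a_{gh}\},\{h,b_{gh}\},\{b_{gh},c_{gh}\},\{c_{gh},d_{gh}\},\{gh,d_{gh}\}$;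 run classical $k$-WL for graphs on $\Gamma_G$ (initial colors of vertex $k$-tuples given by the isomorphism type of the induced ordered subgraph including the equality pattern), and $G,H$ are distinguished iff $\Gamma_G,\Gamma_H$ are.
   Formalization: The gadget gets the additional edge {a_gh, b_gh}; with only the five listed edges Γ_G depends only on |G| and (b) fails (Z/4 vs (Z/2)², k=2, r=1). Also, log n is taken as ⌈log₂ n⌉. *)

(* Defs.v *)
From HB Require Import structures.
From mathcomp Require Import all_boot all_fingroup.
From mathcomp Require Import finmap multiset.
Set Implicit Arguments. Unset Strict Implicit. Unset Printing Implicit Defensive.

Section Refinement.

Variables (k : nat) (C0 : choiceType).

Definition tuple_replace (X : Type) (v : k.-tuple X) (i : 'I_k) (x : X) :
  k.-tuple X := [tuple if j == i then x else tnth v j | j < k].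

Fixpoint wl_color (t : nat) : choiceType :=
  if t is t'.+1
  then (wl_color t' * {mset k.-tuple (wl_color t')}%mset)%type : choiceType
  else C0.

Fixpoint wl_chi (X : finType) (init : k.-tuple X -> C0) (t : nat) :
    k.-tuple X -> wl_color t :=
  if t is t'.+1 then
    fun v =>
      (wl_chi init t' v,
       seq_mset [seq [tuple wl_chi init t' (tuple_replace v i x) | i < k]
                | x <- enum X])
  else init.

(* The initial coloring is round 1, so r >= 1 rounds perform r.-1 refinements. *)
Definition wl_distinguishes (r : nat) (X Y : finType)
    (initX : k.-tuple X -> C0) (initY : k.-tuple Y -> C0) : bool :=
  (#|X| != #|Y|) ||
  (seq_mset [seq wl_chi initX r.-1 v | v <- enum {: k.-tuple X}]
   != seq_mset [seq wl_chi initY r.-1 w | w <- enum {: k.-tuple Y}]).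

End Refinement.

Section VersionI.

Definition init1_color (k : nat) : choiceType :=
  ({ffun 'I_k * 'I_k * 'I_k -> bool} * {ffun 'I_k * 'I_k -> bool})%type.

Definition init1 (k : nat) (G : finGroupType) (g : k.-tuple G) :
    init1_color k :=
  ([ffun p => (tnth g p.1.1 * tnth g p.1.2)%g == tnth g p.2],
   [ffun p => tnth g p.1 == tnth g p.2]).

Definition WL1_distinguishes (k r : nat) (G H : finGroupType) : bool :=
  wl_distinguishes r (@init1 k G) (@init1 k H).

End VersionI.

Section VersionII.

Definition marked_iso (k : nat) (G H : finGroupType)
    (g : k.-tuple G) (h : k.-tuple H) : bool :=
  [exists f : {ffun G -> H},
     misom <<[set x in g]>> <<[set y in h]>> f
     && [forall i, f (tnth g i) == tnth h i]].

(* The initial color of a tuple, taken from K = G or K = H, is its class under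
   marked_iso among all k-tuples of G and of H; see init2P. *)
Definition init2 (k : nat) (G H K : finGroupType) (u : k.-tuple K) :
    {set k.-tuple G + k.-tuple H} :=
  [set z | match z with
           | inl g => marked_iso u g
           | inr h => marked_iso u h
           end].

Definition WL2_distinguishes (k r : nat) (G H : finGroupType) : bool :=
  wl_distinguishes r (@init2 k G H G) (@init2 k G H H).

Lemma marked_iso_refl k (G : finGroupType) (g : k.-tuple G) : marked_iso g g.
Proof.
apply/existsP; exists [ffun x => x]; apply/andP; split; last first.
  by apply/forallP => i; rewrite ffunE.
apply/andP; split; first by apply/forall_inP => u _; rewrite !ffunE.
apply/eqP; apply/setP=> x; apply/imsetP/idP => [[y yA ->]|xA].
  by rewrite ffunE.
by exists x; rewrite ?ffunE.
Qed.

Lemma marked_iso_trans k (G H K : finGroupType)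
    (g : k.-tuple G) (h : k.-tuple H) (u : k.-tuple K) :
  marked_iso g h -> marked_iso h u -> marked_iso g u.
Proof.
move=> /existsP[f /andP[/andP[fM /eqP fE] /forallP fgh]].
move=> /existsP[f' /andP[/andP[fM' /eqP fE'] /forallP fhu]].
have f1 : f 1%g = 1%g.
  by apply: (mulgI (f 1%g)); rewrite -(morphicP fM) ?group1 // !mulg1.
have fin x : x \in <<[set x in g]>>%g -> f x \in <<[set y in h]>>%g.
  move=> xg; case: (eqVneq x 1%g) => [->|x1]; first by rewrite f1 group1.
  have: f x \in (f @: <<[set x in g]>>^#)%g by rewrite imset_f // !inE x1.
  by rewrite fE => /setD1P[].
apply/existsP; exists [ffun x => f' (f x)]; apply/andP; split; last first.
  by apply/forallP => i; rewrite ffunE (eqP (fgh i)).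
apply/andP; split.
  apply/morphicP => x y xg yg; rewrite !ffunE (morphicP fM) //.
  by rewrite (morphicP fM') ?fin.
rewrite /isom -fE' -fE -imset_comp; apply/eqP; apply: eq_imset => x.
by rewrite ffunE.
Qed.

Lemma marked_iso_sym k (G H : finGroupType)
    (g : k.-tuple G) (h : k.-tuple H) :
  marked_iso g h -> marked_iso h g.
Proof.
move=> /existsP[f /andP[mf /forallP fgh]].
have [fM iso] := misomP mf.
have [injf im] := isomP iso.
have gin i : tnth g i \in <<[set x in g]>>%g by rewrite mem_gen // inE mem_tnth.
apply/existsP; exists (finfun (invm injf)); apply/andP; split; last first.
  apply/forallP => i; rewrite ffunE -(eqP (fgh i)) -[f _]/(morphm fM _).
  by rewrite invmE.
have isoV : isom <<[set y in h]>> <<[set x in g]>> (invm injf).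
  have : isom (morphm fM @* <<[set x in g]>>) <<[set x in g]>> (invm injf).
    by apply/isomP; rewrite injm_invm im_invm.
  by rewrite im.
apply/andP; split.
  apply/morphicP => x y; rewrite -im => xh yh.
  by rewrite !ffunE (morphM (invm_morphism injf)).
rewrite /isom; apply/eqP; rewrite -(eqP isoV).
by apply: eq_imset => x; rewrite ffunE.
Qed.

Lemma init2P k (G H K : finGroupType) (u : k.-tuple K) (h : k.-tuple H) :
  reflect (init2 G H u = init2 G H h) (marked_iso u h).
Proof.
apply: (iffP idP) => [uh|/setP/(_ (inr h))].
  apply/setP => -[z|z]; rewrite !inE; apply/idP/idP;
    by [apply/marked_iso_trans/marked_iso_sym | apply: marked_iso_trans].
by rewrite !inE marked_iso_refl.
Qed.

End VersionII.

Section VersionIII.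

Definition init_graph_color (k : nat) : choiceType :=
  ({ffun 'I_k * 'I_k -> bool} * {ffun 'I_k * 'I_k -> bool})%type.

Definition init_graph (k : nat) (V : finType) (e : rel V) (v : k.-tuple V) :
    init_graph_color k :=
  ([ffun p => e (tnth v p.1) (tnth v p.2)],
   [ffun p => tnth v p.1 == tnth v p.2]).

Definition graph_WL_distinguishes (k r : nat) (V W : finType)
    (e : rel V) (e' : rel W) : bool :=
  wl_distinguishes r (@init_graph k V e) (@init_graph k W e').

Variable G : finGroupType.

Definition gamma_vertex : finType := (G + G * G * 'I_4)%type.

Definition elt_v (g : G) : gamma_vertex := inl g.
Definition a_v (g h : G) : gamma_vertex := inr (g, h, @Ordinal 4 0 isT).
Definition b_v (g h : G) : gamma_vertex := inr (g, h, @Ordinal 4 1 isT).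
Definition c_v (g h : G) : gamma_vertex := inr (g, h, @Ordinal 4 2 isT).
Definition d_v (g h : G) : gamma_vertex := inr (g, h, @Ordinal 4 3 isT).

(* The gadget is a tripod centered at b_v g h, with legs of lengths 2, 1, 3 to
   g, h, g * h. Its edge {a_v g h, b_v g h} is what ties g to h and g * h: were
   it omitted, the graph would depend on G only through #|G|. *)
Definition gadget_edges (g h : G) : seq (gamma_vertex * gamma_vertex) :=
  [:: (elt_v g, a_v g h); (elt_v h, b_v g h); (a_v g h, b_v g h);
      (b_v g h, c_v g h); (c_v g h, d_v g h); (elt_v (g * h)%g, d_v g h)].

Definition gamma_edge : rel gamma_vertex := fun u v =>
  [exists g, exists h,
     ((u, v) \in gadget_edges g h) || ((v, u) \in gadget_edges g h)].

End VersionIII.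

Definition WL3_distinguishes (k r : nat) (G H : finGroupType) : bool :=
  graph_WL_distinguishes k r (@gamma_edge G) (@gamma_edge H).

(* Main.v *)
Require Import Defs.
From HB Require Import structures.
From mathcomp Require Import all_boot all_fingroup.
From mathcomp Require Import finmap multiset zify.
Set Implicit Arguments. Unset Strict Implicit. Unset Printing Implicit Defensive.

(** Two tuples get the same color after [t] refinements iff Duplicator survives
    [t] rounds of a bijective pebble game, so each part turns Duplicator's
    strategy in one game into a strategy in another.

    Version III to Version I: a vertex of the graph of [G] is a pair of group
    elements with a type, so [k] vertices occupy [2 k] entries; a move to a
    gadget vertex [(x, y)] is played in two rounds, [x] in the spare entry and
    then [y] in one of the two entries of the moved vertex, whose other entry
    becomes the spare one.

    Version II to Version III: the tuple [g] is represented by the vertices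
    [b_v g_2j g_2j+1], leaving two spare entries.  Vertex types, the two
    components of a [b_v] and their product are recognised in boundedly many
    rounds, so that replacing one [g_i] costs two rounds.  Finally, if
    [g_i |-> h_i] were not to extend to an isomorphism, some product of the
    [g_i] of length at most [n ^ 2] would be answered wrongly; splitting it in
    halves with gadgets exposes a wrong [g_i] in [O(log n)] rounds. *)

(** * Equal multisets of colors as color-preserving bijections *)

(** The permutation between the two lists of colors permutes indices, and [enum_rank] and [enum_val]
    carry it over to the types themselves. *)
Lemma seq_mset_map_bij (C : choiceType) (X Y : finType) (f : X -> C)
    (g : Y -> C) :
  seq_mset [seq f x | x <- enum X] = seq_mset [seq g y | y <- enum Y] ->
  exists2 h : X -> Y, injective h & forall x, f x = g (h x).
Proof.
move/eq_seq_msetP => fg.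
have sz : #|X| = #|Y| by rewrite !cardE -(size_map f) (perm_size fg) size_map.
case: (pickP X) => [x0 _|X0]; last first.
  have noX (x : X) : False by have := X0 x.
  by exists (fun x => False_rect Y (noX x)) => x; case: (noX x).
have Y0 : 0 < #|Y| by rewrite -sz; apply/card_gt0P; exists x0.
have /card_gt0P[y0 _] := Y0.
have [Is IsP fE] := perm_iotaP (g y0) fg.
have sIs : size Is = #|Y| by rewrite (perm_size IsP) size_iota size_map -cardE.
have uIs : uniq Is by rewrite (perm_uniq IsP) iota_uniq.
pose r (x : X) := nth 0 Is (enum_rank x).
have rlt (x : X) : enum_rank x < size Is by rewrite sIs -sz ltn_ord.
have r_lt (x : X) : r x < #|Y|.
  have := mem_nth 0 (rlt x).
  by rewrite (perm_mem IsP) mem_iota size_map -cardE => /andP[].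
exists (fun x => enum_val (Ordinal (r_lt x))).
  move=> x y /enum_val_inj [] /eqP; rewrite nth_uniq // => /eqP.
  by move/val_inj/enum_rank_inj.
move=> x; have := congr1 (fun s => nth (g y0) s (enum_rank x)) fE.
rewrite (nth_map x0) -?cardE // nth_enum_rank (nth_map 0) //.
rewrite (nth_map y0) -?cardE //; last exact: r_lt.
move=> ->; rewrite /enum_val; congr g; apply: set_nth_default.
by rewrite -cardE; apply: r_lt.
Qed.

Lemma bij_seq_mset_map (C : choiceType) (X Y : finType) (f : X -> C)
    (g : Y -> C) (h : X -> Y) :
  #|X| = #|Y| -> injective h -> (forall x, f x = g (h x)) ->
  seq_mset [seq f x | x <- enum X] = seq_mset [seq g y | y <- enum Y].
Proof.
move=> XY hI fgh; apply/eq_seq_msetP.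
rewrite (eq_map fgh) (map_comp g h); apply: perm_map; apply: uniq_perm.
- by rewrite map_inj_uniq ?enum_uniq.
- exact: enum_uniq.
have [h' _ hK] := inj_card_bij hI (eq_leq (esym XY)).
by move=> y; rewrite mem_enum -[y]hK map_f // mem_enum.
Qed.

(** * The bijective pebble game *)

Section Update.

Variables (J : finType) (X : Type).

Definition upd (v : {ffun J -> X}) (i : J) (x : X) : {ffun J -> X} :=
  [ffun j => if j == i then x else v j].

Lemma upd_eq v i x : upd v i x i = x.
Proof. by rewrite ffunE eqxx. Qed.

Lemma upd_neq v i x j : j != i -> upd v i x j = v j.
Proof. by move=> /negPf ji; rewrite ffunE ji. Qed.

Definition relabel (J' : finType) (s : J' -> J) (v : {ffun J -> X}) :
  {ffun J' -> X} := [ffun j => v (s j)].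

End Update.

Lemma relabel_upd (J J' : finType) (X : Type) (s : J' -> J)
    (v : {ffun J -> X}) j x :
  injective s -> relabel s (upd v (s j) x) = upd (relabel s v) j x.
Proof. by move=> sI; apply/ffunP => l; rewrite !ffunE (inj_eq sI). Qed.

(* One round of Duplicator's side of the bijective pebble game per refinement:
   [f] answers all of Spoiler's choices of an element [x] and a pebble [i]. *)
Fixpoint game (J X Y : finType) (R : {ffun J -> X} -> {ffun J -> Y} -> Prop)
    (t : nat) (v : {ffun J -> X}) (w : {ffun J -> Y}) : Prop :=
  if t is t'.+1 then
    game R t' v w /\
    exists2 f : X -> Y, injective f &
      forall x i, game R t' (upd v i x) (upd w i (f x))
  else R v w.

Section GameTheory.

Variables X Y : finType.

Lemma game_le (J : finType) (R : {ffun J -> X} -> {ffun J -> Y} -> Prop)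
    s t v w : s <= t -> game R t v w -> game R s v w.
Proof.
elim: t => [|t IH]; first by rewrite leqn0 => /eqP->.
by rewrite leq_eqVlt => /predU1P[-> //|st [/(IH st)]].
Qed.

Lemma game_answer (J : finType) (R : {ffun J -> X} -> {ffun J -> Y} -> Prop)
    t v w : game R t.+1 v w -> exists2 f : X -> Y, injective f &
    forall x i, game R t (upd v i x) (upd w i (f x)).
Proof. by case. Qed.

Lemma game_init (J : finType) (R : {ffun J -> X} -> {ffun J -> Y} -> Prop)
    t v w : game R t v w -> R v w.
Proof. exact: (@game_le J R 0). Qed.

(** Renames pebbles, in particular swaps a freshly placed one with the one it replaces; injectivity
    of [s] makes a move on one pebble affect one entry only. *)
Lemma game_relabel (J J' : finType) (s : J' -> J)
    (R : {ffun J -> X} -> {ffun J -> Y} -> Prop)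
    (R' : {ffun J' -> X} -> {ffun J' -> Y} -> Prop) :
  injective s ->
  (forall v w, R v w -> R' (relabel s v) (relabel s w)) ->
  forall t v w, game R t v w -> game R' t (relabel s v) (relabel s w).
Proof.
move=> sI RR'; elim=> [|t IH] v w /=; first exact: RR'.
move=> [/IH vw [f fI fP]]; split=> //; exists f => // x i.
by rewrite -!relabel_upd //; apply: IH.
Qed.

Lemma game_mono (J : finType)
    (R R' : {ffun J -> X} -> {ffun J -> Y} -> Prop) :
  (forall v w, R v w -> R' v w) ->
  forall t v w, game R t v w -> game R' t v w.
Proof.
move=> RR'; elim=> [|t IH] v w /=; first exact: RR'.
by move=> [/IH vw [f fI fP]]; split=> //; exists f => // x i; apply: IH.
Qed.

End GameTheory.

(** * Refined colors as winning positions *)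

Section Tuples.

Variable k : nat.

Definition tuple_ffun (X : Type) (v : k.-tuple X) : {ffun 'I_k -> X} :=
  [ffun i => tnth v i].

Definition ffun_tuple (X : Type) (v : {ffun 'I_k -> X}) : k.-tuple X :=
  [tuple v i | i < k].

Lemma tuple_ffunK X : cancel (@tuple_ffun X) (@ffun_tuple X).
Proof. by move=> v; apply: eq_from_tnth => i; rewrite tnth_mktuple ffunE. Qed.

Lemma ffun_tupleK X : cancel (@ffun_tuple X) (@tuple_ffun X).
Proof. by move=> v; apply/ffunP => i; rewrite ffunE tnth_mktuple. Qed.

Lemma tuple_ffun_replace X (v : k.-tuple X) i x :
  tuple_ffun (tuple_replace v i x) = upd (tuple_ffun v) i x.
Proof. by apply/ffunP => j; rewrite !ffunE tnth_mktuple. Qed.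

Variables (C0 : choiceType) (X Y : finType).
Variables (iX : k.-tuple X -> C0) (iY : k.-tuple Y -> C0).

Definition same_init (v : {ffun 'I_k -> X}) (w : {ffun 'I_k -> Y}) : Prop :=
  iX (ffun_tuple v) = iY (ffun_tuple w).

(** The replacements of all entries by the same [x] form one element of the refining multiset, so a
    single bijection, fixed before the pebble is chosen, matches them all. *)
Lemma wl_chiP t v w : #|X| = #|Y| ->
  wl_chi iX t v = wl_chi iY t w <->
  game same_init t (tuple_ffun v) (tuple_ffun w).
Proof.
move=> XY; elim: t v w => [|t IH] v w /=.
  by rewrite /same_init !tuple_ffunK.
split.
  case=> /IH vw /seq_mset_map_bij [f fI fP]; split=> //; exists f => // x i.
  rewrite -!tuple_ffun_replace; apply/IH.
  by have := congr1 (fun u => tnth u i) (fP x); rewrite !tnth_mktuple.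
case=> /IH-> [f fI fP]; congr (_, _).
apply: (bij_seq_mset_map XY fI) => x; apply: eq_from_tnth => i.
by rewrite !tnth_mktuple; apply/IH; rewrite !tuple_ffun_replace.
Qed.

Lemma wl_distinguishesPn r : #|X| = #|Y| ->
  (~~ wl_distinguishes r iX iY) <->
  exists2 F : {ffun 'I_k -> X} -> {ffun 'I_k -> Y}, injective F &
    forall v, game same_init r.-1 v (F v).
Proof.
move=> XY; rewrite /wl_distinguishes XY eqxx /= negbK; split.
  move/eqP/seq_mset_map_bij => [F FI FP].
  exists (fun v => tuple_ffun (F (ffun_tuple v))).
    move=> u v /(can_inj (@tuple_ffunK Y))/FI.
    exact: (can_inj (@ffun_tupleK X)).
  by move=> v; rewrite -[v in game _ _ v _]ffun_tupleK; apply/wl_chiP.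
case=> F FI FP; apply/eqP.
apply: (@bij_seq_mset_map _ _ _ _ _ (fun v => ffun_tuple (F (tuple_ffun v)))).
- by rewrite !card_tuple XY.
- move=> u v /(can_inj (@ffun_tupleK Y))/FI.
  exact: (can_inj (@tuple_ffunK X)).
by move=> v; apply/wl_chiP => //; rewrite ffun_tupleK.
Qed.

End Tuples.

Lemma card_eq_bij (S T : finType) : #|S| = #|T| ->
  exists2 s : S -> T, injective s &
    exists2 s' : T -> S, cancel s s' & cancel s' s.
Proof.
move=> ST; pose s (x : S) : T := enum_val (cast_ord ST (enum_rank x)).
have sI : injective s by move=> x y /enum_val_inj/cast_ord_inj/enum_rank_inj.
exists s => //; have [s' sK s'K] := inj_card_bij sI (eq_leq (esym ST)).
by exists s'.
Qed.

(** Allows entries to be indexed by a type that reflects their role, such as pairs plus spare slots,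
    instead of by ['I_k]. *)
Lemma wl_equivalent_relabel (k : nat) (J : finType) (C0 : choiceType)
    (X Y : finType) (iX : k.-tuple X -> C0) (iY : k.-tuple Y -> C0)
    (R : {ffun J -> X} -> {ffun J -> Y} -> Prop) (r : nat) :
  #|X| = #|Y| -> #|J| = k ->
  (forall (s : J -> 'I_k) v w, injective s ->
     same_init iX iY v w -> R (relabel s v) (relabel s w)) ->
  ~~ wl_distinguishes r iX iY ->
  exists2 F : {ffun J -> X} -> {ffun J -> Y}, injective F &
    forall v, game R r.-1 v (F v).
Proof.
move=> XY Jk RP /(wl_distinguishesPn _ _ _ XY) [F FI FP].
have [|s sI [s' sK s'K]] := @card_eq_bij J 'I_k; first by rewrite card_ord.
have reK Z : cancel (@relabel _ Z _ s') (@relabel _ Z _ s).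
  by move=> v; apply/ffunP => j; rewrite !ffunE sK.
have reK' Z : cancel (@relabel _ Z _ s) (@relabel _ Z _ s').
  by move=> v; apply/ffunP => j; rewrite !ffunE s'K.
exists (fun v => relabel s (F (relabel s' v))).
  by move=> u v /(can_inj (@reK' _))/FI/(can_inj (@reK _)).
move=> v; rewrite -[v in game _ _ v _]reK; apply: game_relabel (FP _) => //.
by move=> u w; apply: RP.
Qed.

(** * Version I against Version II *)

(** An isomorphism of the generated subgroups is multiplicative and injective, so it preserves and
    reflects products and equalities of entries. *)
Lemma marked_iso_init1 k (G H : finGroupType) (g : k.-tuple G)
    (h : k.-tuple H) : marked_iso g h -> init1 g = init1 h.
Proof.
case/existsP=> f /andP[/misomP[fM /isomP[fI _]] /forallP fgh].
have gin i : tnth g i \in <<[set x in g]>>%g by rewrite mem_gen // inE mem_tnth.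
have fE i : morphm fM (tnth g i) = tnth h i by apply/eqP/fgh.
have /injmP fI' := fI.
congr (_, _); apply/ffunP => p; rewrite !ffunE -!fE.
  by rewrite -(morphM (morphm_morphism fM)) // (inj_in_eq fI') ?groupM.
by rewrite (inj_in_eq fI').
Qed.

Lemma WL1_WL2 (G H : finGroupType) k r : #|G| = #|H| ->
  WL1_distinguishes k r G H -> WL2_distinguishes k r G H.
Proof.
move=> GH; apply: contraLR => /(wl_distinguishesPn _ _ _ GH) [F FI FP].
apply/(wl_distinguishesPn _ _ _ GH); exists F => // v.
by apply: game_mono (FP v) => u w /init2P/marked_iso_init1.
Qed.

(** * Version III against Version I: coding vertices by group elements *)

Definition elt_adj (G : finGroupType) (x g h : G) (i : 'I_4) : bool :=
  [|| (i == 0 :> nat) && (x == g), (i == 1 :> nat) && (x == h)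
    | (i == 3 :> nat) && (x == g * h)%g].

Lemma ord4P (i : 'I_4) :
  [\/ i = @Ordinal 4 0 isT, i = @Ordinal 4 1 isT, i = @Ordinal 4 2 isT
    | i = @Ordinal 4 3 isT].
Proof.
by case: i => [[|[|[|[|]]]] lt4] //;
  [apply: Or41|apply: Or42|apply: Or43|apply: Or44]; apply: val_inj.
Qed.

Lemma gamma_edgeE (G : finGroupType) (u v : gamma_vertex G) :
  gamma_edge u v =
  match u, v with
  | inl _, inl _ => false
  | inl x, inr (g, h, i) | inr (g, h, i), inl x => elt_adj x g h i
  | inr p, inr q =>
      (p.1 == q.1) && ((p.2.+1 == q.2 :> nat) || (q.2.+1 == p.2 :> nat))
  end.
Proof.
apply/idP/idP.
  case/existsP=> g /existsP[h]; case/orP; rewrite !inE;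
  (repeat case/orP); case/eqP=> -> ->;
  by rewrite /elt_adj /= ?eqxx ?orbT.
have E (p q : gamma_vertex G) g h : ((p, q) \in gadget_edges g h) ||
    ((q, p) \in gadget_edges g h) -> gamma_edge p q.
  by move=> pq; apply/existsP; exists g; apply/existsP; exists h.
case: u v => [x|[[g h] i]] [y|[[g' h'] i']] //=.
- by case: (ord4P i') => ->; rewrite /elt_adj /= ?orbF // => /eqP->;
    apply: (E _ _ g' h'); rewrite !inE eqxx ?orbT.
- by case: (ord4P i) => ->; rewrite /elt_adj /= ?orbF // => /eqP->;
    apply: (E _ _ g h); rewrite !inE eqxx ?orbT.
case/andP=> /eqP[-> ->].
by case: (ord4P i) => ->; case: (ord4P i') => -> //= _;
    apply: (E _ _ g' h'); rewrite !inE eqxx ?orbT.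
Qed.

Definition same_graph_type (J X Y : finType) (e : rel X) (e' : rel Y)
    (v : {ffun J -> X}) (w : {ffun J -> Y}) : Prop :=
  forall i j, (e (v i) (v j) = e' (w i) (w j)) /\
              ((v i == v j) = (w i == w j)).

Lemma same_init_graphP k (X Y : finType) (e : rel X) (e' : rel Y)
    (v : {ffun 'I_k -> X}) (w : {ffun 'I_k -> Y}) :
  same_init (init_graph e) (init_graph e') v w <-> same_graph_type e e' v w.
Proof.
split=> [[/ffunP E1 /ffunP E2] i j|E].
  by have := E1 (i, j); have := E2 (i, j); rewrite !ffunE /= !tnth_mktuple.
by congr (_, _); apply/ffunP => p; rewrite !ffunE /= !tnth_mktuple;
  case: (E p.1 p.2).
Qed.

Definition same_mul_type (J : finType) (G H : finGroupType)
    (v : {ffun J -> G}) (w : {ffun J -> H}) : Prop :=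
  (forall i j l, (v i * v j == v l)%g = (w i * w j == w l)%g) /\
  (forall i j, (v i == v j) = (w i == w j)).

Lemma same_init1P k (G H : finGroupType)
    (v : {ffun 'I_k -> G}) (w : {ffun 'I_k -> H}) :
  same_init (@init1 k G) (@init1 k H) v w -> same_mul_type v w.
Proof.
case=> /ffunP E1 /ffunP E2; split=> [i j l|i j].
  by have := E1 (i, j, l); rewrite !ffunE /= !tnth_mktuple.
by have := E2 (i, j); rewrite !ffunE /= !tnth_mktuple.
Qed.

Lemma same_mul_type_relabel (J J' : finType) (s : J' -> J)
    (G H : finGroupType) (v : {ffun J -> G}) (w : {ffun J -> H}) :
  same_mul_type v w -> same_mul_type (relabel s v) (relabel s w).
Proof. by case=> E1 E2; split=> *; rewrite !ffunE. Qed.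

Section Decode.

Variable k : nat.

(** Entry [None] is the spare one. Types are kept outside the game, since the simulation gives both
    players the same ones. *)
Definition dec (G : finGroupType) (ty : {ffun 'I_k -> option 'I_4})
    (v : {ffun option ('I_k * bool) -> G}) : {ffun 'I_k -> gamma_vertex G} :=
  [ffun i => if ty i is Some s
             then inr (v (Some (i, false)), v (Some (i, true)), s)
             else inl (v (Some (i, false)))].

Lemma dec_same_type (G H : finGroupType) ty
    (v : {ffun option ('I_k * bool) -> G})
    (w : {ffun option ('I_k * bool) -> H}) :
  same_mul_type v w ->
  same_graph_type (@gamma_edge G) (@gamma_edge H) (dec ty v) (dec ty w).
Proof.
case=> EM E i j; rewrite !gamma_edgeE !ffunE.
have EM' a b c : (v a == v b * v c)%g = (w a == w b * w c)%g.
  by rewrite ![_ == (_ * _)%g]eq_sym.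
case: (ty i) (ty j) => [s|] [s'|]; rewrite /elt_adj /= ?E ?EM' //.
- by rewrite !xpair_eqE !E; split=> //; rewrite !eqE /= !eqE /= !eqE /= !E.
- by split=> //; rewrite !eqE /= E.
Qed.

Lemma dec_game (G H : finGroupType) t ty
    (v : {ffun option ('I_k * bool) -> G})
    (w : {ffun option ('I_k * bool) -> H}) :
  game (@same_mul_type _ G H) (2 * t) v w ->
  game (same_graph_type (@gamma_edge G) (@gamma_edge H)) t
       (dec ty v) (dec ty w).
Proof.
elim: t ty v w => [|t IH] ty v w; first exact: dec_same_type.
have -> : 2 * t.+1 = (2 * t).+2 by lia.
move=> vw; split; first by apply: IH; apply: game_le vw; lia.
case: vw => _ [f fI fP].
(* The second-round answer depends on the element [x] played first, so one bijection is chosen for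
   each [x]. *)
have /fin_all_exists[f2 f2P] (x : G) : exists f2 : G -> H, injective f2 /\
    forall y i, game (@same_mul_type _ G H) (2 * t)
      (upd (upd v None x) i y) (upd (upd w None (f x)) i (f2 y)).
  by case: (fP x None) => _ [f2 f2I f2P]; exists f2.
pose F (z : gamma_vertex G) : gamma_vertex H :=
  match z with inl x => inl (f x)
             | inr (x, y, s) => inr (f x, f2 x y, s) end.
exists F.
  move=> [x|[[x y] s]] [x'|[[x' y'] s']] //= [].
    by move/fI->.
  by move=> /fI-> /(proj1 (f2P x'))-> ->.
(* After this swap the new first component sits in its proper entry and the old one becomes the
   spare entry. *)
move=> z i; pose sw := tperm None (Some (i, false)).
have swE : sw (Some (i, false)) = None by rewrite tpermR.
have swO j b : b || (j != i) -> sw (Some (j, b)) = Some (j, b).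
  move=> jb; rewrite tpermD // (inj_eq (@Some_inj _)) xpair_eqE eq_sym.
  by case: b jb => /= [_|/negPf->]; rewrite ?andbF.
have swap v' w' : game (@same_mul_type _ G H) (2 * t) v' w' ->
    game (@same_mul_type _ G H) (2 * t) (relabel sw v') (relabel sw w').
  apply: game_relabel; first exact: perm_inj.
  by move=> ? ?; apply: same_mul_type_relabel.
case: z => [x|[[x y] s]] /=.
  (* A plain element takes only one round; the other is given up. *)
  have /swap/(IH (upd ty i None)) : game (@same_mul_type _ G H) (2 * t)
      (upd v None x) (upd w None (f x)).
    by case: (fP x None).
  congr game; apply/ffunP => j; rewrite !ffunE;
    case: (eqVneq j i) => [->|ji]; rewrite ?swE ?swO ?ji ?orbT //=.
have /swap/(IH (upd ty i (Some s))) := (proj2 (f2P x)) y (Some (i, true)).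
congr game; apply/ffunP => j; rewrite !ffunE;
  case: (eqVneq j i) => [->|ji];
  rewrite ?swE ?swO ?ji ?orbT //= ?(inj_eq (@Some_inj _)) ?xpair_eqE ?eqxx
          ?(negPf ji) //.
Qed.

Definition vfst (G : finGroupType) (z : gamma_vertex G) : G :=
  match z with inl x => x | inr (g, _, _) => g end.
Definition vsnd (G : finGroupType) (z : gamma_vertex G) : G :=
  match z with inl x => x | inr (_, h, _) => h end.
Definition vtype (G : finGroupType) (z : gamma_vertex G) : option 'I_4 :=
  match z with inl _ => None | inr (_, _, s) => Some s end.

(* The slot a plain element leaves free and the spare slot carry copies, so that
   an answer to [enc i0 u] is determined by its decoding. *)
Definition enc (i0 : 'I_k) (G : finGroupType)
    (u : {ffun 'I_k -> gamma_vertex G}) :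
    {ffun option ('I_k * bool) -> G} :=
  [ffun j => match j with
             | Some (i, false) => vfst (u i)
             | Some (i, true) => vsnd (u i)
             | None => vfst (u i0)
             end].

End Decode.

Lemma WL3_WL1 (G H : finGroupType) k r : #|G| = #|H| -> 0 < k -> 0 < r ->
  WL3_distinguishes k r G H -> WL1_distinguishes (2 * k + 1) (2 * r) G H.
Proof.
move=> GH k0 r0; apply: contraLR => Hd.
pose J : finType := option ('I_k * bool).
have VV : #|gamma_vertex G| = #|gamma_vertex H|.
  by rewrite !card_sum !card_prod GH.
have [||F FI FP] :=
  @wl_equivalent_relabel _ J _ _ _ _ _ (@same_mul_type J G H) _ GH _ _ Hd.
- by rewrite card_option card_prod card_ord card_bool; lia.
- by move=> s v w _ /same_init1P; apply: same_mul_type_relabel.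
pose i0 := Ordinal k0.
apply/(wl_distinguishesPn _ _ _ VV).
pose ty (u : {ffun 'I_k -> gamma_vertex G}) := [ffun i => vtype (u i)].
have enc_dec u : dec (ty u) (enc i0 u) = u.
  by apply/ffunP => i; rewrite !ffunE; case: (u i) => [x|[[x y] s]].
exists (fun u => dec (ty u) (F (enc i0 u))).
  move=> u u' /ffunP E.
  have Ety : ty u = ty u'.
    apply/ffunP => i; have := congr1 (@vtype H) (E i); rewrite !ffunE.
    by case: (u i) => [?|[[? ?] ?]]; case: (u' i) => [?|[[? ?] ?]].
  have Efst i :
      F (enc i0 u) (Some (i, false)) = F (enc i0 u') (Some (i, false)).
    have := congr1 (@vfst H) (E i); rewrite !ffunE.
    by case: (u i) => [?|[[? ?] ?]]; case: (u' i) => [?|[[? ?] ?]].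
  (* Equal entries receive equal answers, which recovers the entries of the answer that decoding
     does not show. *)
  have copy (z : {ffun 'I_k -> gamma_vertex G}) i j :
      enc i0 z i = enc i0 z j -> F (enc i0 z) i = F (enc i0 z) j.
    move=> /eqP zij; apply/eqP.
    by case: (game_init (FP (enc i0 z))) => _ <-.
  suff EF : F (enc i0 u) = F (enc i0 u').
    by rewrite -(enc_dec u) -(enc_dec u') Ety (FI _ _ EF).
  apply/ffunP => -[[i []]|] //.
    case ui: (vtype (u i)) => [s|].
      have := congr1 (@vsnd H) (E i).
      by rewrite ![dec _ _ i]ffunE -Ety ffunE ui.
    have u'i : vtype (u' i) = None.
      by move/ffunP/(_ i): Ety; rewrite !ffunE => <-.
    rewrite (copy u (Some (i, true)) (Some (i, false))); last first.
      by rewrite !ffunE; case: (u i) ui => [?|[[? ?] ?]].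
    rewrite (copy u' (Some (i, true)) (Some (i, false))) ?Efst //.
    by rewrite !ffunE; case: (u' i) u'i => [?|[[? ?] ?]].
  by rewrite (copy u None (Some (i0, false))) ?(copy u' None (Some (i0, false)))
             ?Efst // !ffunE.
move=> u; rewrite -[u in game _ _ u _]enc_dec.
apply: (game_mono (R := same_graph_type (@gamma_edge G) (@gamma_edge H))).
  by move=> v w /same_init_graphP.
(* The count is [2 * r.-1 <= (2 * r).-1], as the first round of each version is the initial
   coloring. *)
by apply: dec_game; apply: game_le (FP _); lia.
Qed.

(** * Graph descriptions of vertex types and gadget components *)

Local Notation ta := (Some (@Ordinal 4 0 isT)).
Local Notation tb := (Some (@Ordinal 4 1 isT)).
Local Notation tc := (Some (@Ordinal 4 2 isT)).
Local Notation td := (Some (@Ordinal 4 3 isT)).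

Section VertexTypes.

Variable G : finGroupType.
Implicit Types z : gamma_vertex G.

(** Gadget vertices have at most three neighbors, whereas a group element serves as first and as
    second factor in gadgets with each of two distinct partners. *)
Lemma degree_eltE z : 1 < #|G| ->
  (3 < #|gamma_edge z|) = (vtype z == None).
Proof.
move=> G1.
have small s : {subset gamma_edge z <= s} -> size s <= 3 ->
    (3 < #|gamma_edge z|) = false.
  move=> zs s3; apply/negbTE; rewrite -leqNgt; apply: leq_trans s3.
  by apply: leq_trans (card_size s); apply/subset_leq_card/subsetP.
case: z small => [x|[[g h] i]] small /=; last first.
  pose s : seq (gamma_vertex G) :=
    if i == 0 :> nat then [:: elt_v g; b_v g h]
    else if i == 1 :> nat then [:: elt_v h; a_v g h; c_v g h]
    else if i == 2 :> nat then [:: b_v g h; d_v g h]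
    else [:: c_v g h; elt_v (g * h)%g].
  rewrite (small s); last by rewrite /s; case: ifP => // _; case: ifP => // _;
    case: ifP.
  - by case: (ord4P i) => ->.
  move=> y; rewrite -[y \in _]/(gamma_edge _ y) gamma_edgeE /s.
  case: y => [x|[[g' h'] i']]; case: (ord4P i) => -> //=;
    rewrite /elt_adj /= ?orbF //;
    first (by move/eqP->; rewrite !inE eqxx orbT);
    case/andP=> /eqP[<- <-]; case: (ord4P i') => -> //= _;
    by rewrite !inE eqxx ?orbT.
apply/idP; apply/card_geqP.
have [a [b [_ _ ab]]] := card_gt1P G1.
exists [:: a_v x a; a_v x b; b_v a x; b_v b x]; split=> //.
  rewrite /= !inE /a_v /b_v !(inj_eq (@inr_inj _ _)) !xpair_eqE.
  have -> : (@Ordinal 4 0 isT == @Ordinal 4 1 isT) = false by [].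
  by rewrite (negPf ab) !andbF.
move=> y; rewrite -[y \in gamma_edge _]/(gamma_edge _ y) gamma_edgeE !inE.
by case/or4P => /eqP->; rewrite /= /elt_adj /= eqxx ?orbT.
Qed.

Definition nbr_type (ty : option 'I_4) z : bool :=
  [exists y, gamma_edge z y && (vtype y == ty)].

Lemma nbr_type_elt z : nbr_type None z = (vtype z \in [:: ta; tb; td]).
Proof.
apply/existsP/idP => [[[x|[[g h] i]]] /andP[]|]; rewrite ?gamma_edgeE ?andbF //.
  case: z => [//|[[g h] i]] /=.
  by case: (ord4P i) => ->; rewrite /elt_adj /= ?orbF.
case: z => [//|[[g h] i]]; rewrite !inE /=; case/or3P => /eqP[->].
- by exists (elt_v g); rewrite gamma_edgeE /elt_adj /= !eqxx.
- by exists (elt_v h); rewrite gamma_edgeE /elt_adj /= !eqxx.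
by exists (elt_v (g * h)%g); rewrite gamma_edgeE /elt_adj /= !eqxx.
Qed.

Lemma nbr_type_c z : nbr_type tc z = (vtype z \in [:: tb; td]).
Proof.
apply/existsP/idP => [[[x|[[g h] i]]] /andP[]|]; rewrite ?gamma_edgeE ?andbF //.
  move=> e /eqP[iE]; rewrite iE in e.
  case: z e => [//|[[g' h'] i']] /andP[_].
  by case: (ord4P i') => ->.
case: z => [//|[[g h] i]]; rewrite !inE /=; case/orP => /eqP[->];
  by exists (c_v g h); rewrite gamma_edgeE /= !eqxx.
Qed.

Lemma nbr_type_a z : nbr_type ta z = (vtype z \in [:: None; tb]).
Proof.
apply/existsP/idP => [[[x|[[g h] i]]] /andP[]|]; rewrite ?gamma_edgeE ?andbF //.
  move=> e /eqP[iE]; rewrite iE in e.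
  case: z e => [//|[[g' h'] i']] /andP[_].
  by case: (ord4P i') => ->.
case: z => [x _|[[g h] i]].
  by exists (a_v x x); rewrite gamma_edgeE /= /elt_adj /= !eqxx.
rewrite !inE /= => /eqP[->].
by exists (a_v g h); rewrite gamma_edgeE /= !eqxx.
Qed.


Definition side (s : bool) z : G := if s then vsnd z else vfst z.

(** Between an element and a [b_v], the paths of [first_rel] and [prod_rel] run along the legs of
    the tripod leading to the first factor and to the product; the leg to the second factor is a
    single edge. *)
Definition first_rel z m : bool :=
  [exists y, (vtype y == ta) && gamma_edge z y && gamma_edge y m].
Definition prod_rel z m : bool :=
  [exists y, [exists y', (vtype y' == td) && gamma_edge z y' && gamma_edge y' y]
             && ((vtype y == tc) && gamma_edge y m)].

Lemma second_relE z m : vtype z = None -> vtype m = tb ->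
  gamma_edge z m = (vfst z == vsnd m).
Proof.
case: z m => [x|[[? ?] ?]] [?|[[g h] i]] //= _ [->].
by rewrite gamma_edgeE /elt_adj /= orbF.
Qed.

Lemma first_relE z m : vtype z = None -> vtype m = tb ->
  first_rel z m = (vfst z == vfst m).
Proof.
case: z m => [x|[[? ?] ?]] [?|[[g h] i]] //= _ [->].
apply/existsP/eqP => [[[//|[[g' h'] i']]]|->].
  case/andP=> /andP[/eqP/=[->]]; rewrite !gamma_edgeE /elt_adj /= orbF.
  by move=> /eqP-> /andP[/eqP[->]].
by exists (a_v g h); rewrite !gamma_edgeE /= /elt_adj /= !eqxx.
Qed.

Lemma prod_relE z m : vtype z = None -> vtype m = tb ->
  prod_rel z m = (vfst z == vfst m * vsnd m)%g.
Proof.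
case: z m => [x|[[? ?] ?]] [?|[[g h] i]] //= _ [->].
apply/existsP/eqP => [[[|[[g' h'] i']]]|->].
- by move=> y; rewrite andbF.
- case/andP=> /existsP[[//|[[g1 h1] i1]]] /andP[/andP[/eqP/=[->]]].
  rewrite !gamma_edgeE /elt_adj /= => /eqP-> /andP[/eqP[-> ->] _].
  by case/andP=> /eqP[_] /andP[/eqP[-> ->]].
exists (c_v g h); rewrite !gamma_edgeE /= !eqxx !andbT.
by apply/existsP; exists (d_v g h); rewrite !gamma_edgeE /= /elt_adj /= !eqxx.
Qed.

End VertexTypes.

(** * Properties that Duplicator must preserve *)

Lemma exists_bij (X Y : finType) (f : X -> Y) (P : pred X) (Q : pred Y) :
  #|X| = #|Y| -> injective f -> (forall x, P x = Q (f x)) ->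
  [exists x, P x] = [exists y, Q y].
Proof.
move=> XY fI PQ; have [f' _ f'K] := inj_card_bij fI (eq_leq (esym XY)).
apply/existsP/existsP => [[x Px]|[y Qy]]; first by exists (f x); rewrite -PQ.
by exists (f' y); rewrite PQ f'K.
Qed.

Section Preservation.

Variables (J : finType) (G H : finGroupType).
Hypothesis third : forall i j : J, exists2 l, l != i & l != j.
Hypothesis GH : #|G| = #|H|.
Hypothesis G1 : 1 < #|G|.

Notation sim :=
  (game (@same_graph_type J _ _ (@gamma_edge G) (@gamma_edge H))).

Lemma card_gamma_vertex : #|gamma_vertex G| = #|gamma_vertex H|.
Proof. by rewrite !card_sum !card_prod GH. Qed.
Let VV := card_gamma_vertex.

(** Agreement on every pebble whenever at least [t] rounds remain; [t] thus bounds the quantifier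
    depth needed to express [P]. *)
Definition pres1 (T : Type) t (P : gamma_vertex G -> T)
    (P' : gamma_vertex H -> T) : Prop :=
  forall s v w i, t <= s -> sim s v w -> P (v i) = P' (w i).

Definition pres2 t (P : rel (gamma_vertex G)) (P' : rel (gamma_vertex H)) :
    Prop :=
  forall s v w i j, t <= s -> i != j -> sim s v w ->
    P (v i) (v j) = P' (w i) (w j).

Lemma pres2_edge t : pres2 t (@gamma_edge G) (@gamma_edge H).
Proof. by move=> s v w i j _ _ /game_init/(_ i j)[]. Qed.

Lemma pres2_and t P P' Q Q' : pres2 t P P' -> pres2 t Q Q' ->
  pres2 t (fun x y => P x y && Q x y) (fun x y => P' x y && Q' x y).
Proof. by move=> PP QQ s v w i j ts ij vw; rewrite (PP s v w) ?(QQ s v w). Qed.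

Lemma pres2_l t P P' : pres1 t P P' ->
  pres2 t (fun x _ => P x) (fun x _ => P' x).
Proof. by move=> PP s v w i j ts ij; apply: PP. Qed.

Lemma pres2_r t P P' : pres1 t P P' -> pres2 t (fun _ => P) (fun _ => P').
Proof. by move=> PP s v w i j ts ij; apply: PP. Qed.

Lemma pres1_ex t P P' : pres2 t P P' ->
  pres1 t.+1 (fun x => [exists y, P x y]) (fun x => [exists y, P' x y]).
Proof.
move=> PP [//|s] v w i ts [_ [f fI fP]].
apply: (exists_bij VV fI) => x.
have [l li _] := third i i.
have := PP s _ _ i l ts _ (fP x l).
by rewrite !upd_eq !upd_neq 1?eq_sym //; apply.
Qed.

(** A quantifier costs one round: the witness is placed on a third pebble, so that both [i] and [j]
    stay in place. *)
Lemma pres2_ex t P P' Q Q' : pres2 t P P' -> pres2 t Q Q' ->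
  pres2 t.+1 (fun x y => [exists z, P x z && Q z y])
             (fun x y => [exists z, P' x z && Q' z y]).
Proof.
move=> PP QQ [//|s] v w i j ts ij [_ [f fI fP]].
apply: (exists_bij VV fI) => x.
have [l li lj] := third i j.
have il : i != l by rewrite eq_sym.
have jl : j != l by rewrite eq_sym.
have := PP s _ _ i l ts il (fP x l); have := QQ s _ _ l j ts lj (fP x l).
by rewrite !upd_eq !(upd_neq _ _ il) !(upd_neq _ _ jl) => -> ->.
Qed.

(** The answering bijection maps neighbors onto neighbors, so degrees agree, and degree singles out
    the group elements. *)
Lemma pres1_elt : pres1 1 (fun z => vtype z == None) (fun z => vtype z == None).
Proof.
move=> [//|s] v w i _ [_ [f fI fP]].
rewrite -!degree_eltE -?GH //; congr (_ < _).
have [f' fK f'K] := inj_card_bij fI (eq_leq (esym VV)).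
have [l li _] := third i i.
rewrite -(@on_card_preimset _ _ f (gamma_edge (w i))); last first.
  by apply: onW_bij; exists f'.
apply: eq_card => x; rewrite [RHS]inE.
rewrite -[LHS]/(gamma_edge _ x) -[RHS]/(gamma_edge _ (f x)).
have [] := game_init (fP x l) i l.
by rewrite !upd_eq !upd_neq // eq_sym.
Qed.

Lemma pres1_nbr t ty :
  pres1 t (fun z => vtype z == ty) (fun z => vtype z == ty) ->
  pres1 t.+1 (nbr_type ty) (nbr_type ty).
Proof.
move=> /pres2_r tyP; apply: pres1_ex; apply: pres2_and tyP.
exact: pres2_edge.
Qed.

Lemma pres1_c : pres1 2 (fun z => vtype z == tc) (fun z => vtype z == tc).
Proof.
move=> s v w i ts vw.
have := pres1_elt i (ltnW ts) vw; have := pres1_nbr pres1_elt i ts vw.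
rewrite !nbr_type_elt.
case: (vtype (v i)) => [x|]; case: (vtype (w i)) => [y|] //.
by case: (ord4P x) => ->; case: (ord4P y) => ->.
Qed.

Lemma pres1_a : pres1 3 (fun z => vtype z == ta) (fun z => vtype z == ta).
Proof.
move=> s v w i ts vw.
have := pres1_elt i (ltnW (ltnW ts)) vw.
have := pres1_nbr pres1_elt i (ltnW ts) vw; have := pres1_nbr pres1_c i ts vw.
rewrite !nbr_type_elt !nbr_type_c.
case: (vtype (v i)) => [x|]; case: (vtype (w i)) => [y|] //.
by case: (ord4P x) => ->; case: (ord4P y) => ->.
Qed.

(** Types are settled one by one: [c_v] alone has no element as neighbor, [a_v] is then the one
    without a [c_v] neighbor, and [b_v] differs from [d_v] by its [a_v] neighbor. *)
Lemma pres1_vtype : pres1 4 (@vtype G) (@vtype H).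
Proof.
move=> s v w i ts vw.
have := pres1_elt i (ltnW (ltnW (ltnW ts))) vw.
have := pres1_nbr pres1_elt i (ltnW (ltnW ts)) vw.
have := pres1_nbr pres1_c i (ltnW ts) vw; have := pres1_nbr pres1_a i ts vw.
rewrite !nbr_type_elt !nbr_type_c !nbr_type_a.
case: (vtype (v i)) => [x|]; case: (vtype (w i)) => [y|] //.
by case: (ord4P x) => ->; case: (ord4P y) => ->.
Qed.

Lemma pres1_vtype_eq t ty : 4 <= t ->
  pres1 t (fun z => vtype z == ty) (fun z => vtype z == ty).
Proof.
move=> t4 s v w i ts vw; congr (_ == _).
by apply: pres1_vtype vw; apply: leq_trans ts.
Qed.

Lemma pres2_first : pres2 5 (@first_rel G) (@first_rel H).
Proof.
apply: pres2_ex; last exact: pres2_edge.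
apply: pres2_and; last exact: pres2_edge.
exact/pres2_r/pres1_vtype_eq.
Qed.

Lemma pres2_prod : pres2 6 (@prod_rel G) (@prod_rel H).
Proof.
apply: pres2_ex; last first.
  apply: pres2_and; last exact: pres2_edge.
  exact/pres2_l/pres1_vtype_eq.
apply: pres2_ex; last exact: pres2_edge.
apply: pres2_and; last exact: pres2_edge.
exact/pres2_r/pres1_vtype_eq.
Qed.

Lemma side_eq s b v w i j : 6 <= s -> i != j -> sim s v w ->
  vtype (v i) = None -> vtype (v j) = tb ->
  (vfst (v i) == side b (v j)) = (vfst (w i) == side b (w j)).
Proof.
move=> s6 ij vw vi vj.
have wi : vtype (w i) = None by rewrite -(pres1_vtype i _ vw) //; lia.
have wj : vtype (w j) = tb by rewrite -(pres1_vtype j _ vw) //; lia.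
case: b; rewrite /side -?first_relE -?second_relE //.
  exact: (pres2_edge (leq0n s)).
by apply: pres2_first vw => //; lia.
Qed.

Lemma prod_eq s v w i j : 6 <= s -> i != j -> sim s v w ->
  vtype (v i) = None -> vtype (v j) = tb ->
  (vfst (v i) == vfst (v j) * vsnd (v j))%g =
  (vfst (w i) == vfst (w j) * vsnd (w j))%g.
Proof.
move=> s6 ij vw vi vj.
have wi : vtype (w i) = None by rewrite -(pres1_vtype i _ vw) //; lia.
have wj : vtype (w j) = tb by rewrite -(pres1_vtype j _ vw) //; lia.
by rewrite -!prod_relE //; apply: pres2_prod vw.
Qed.

(** With a free pebble placed on the shared component, the reply must be the corresponding component
    of both answers. *)
Lemma side_shared s b b' v w i j : 7 <= s -> sim s v w ->
  vtype (v i) = tb -> vtype (v j) = tb ->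
  side b (v i) = side b' (v j) -> side b (w i) = side b' (w j).
Proof.
case: s => [//|s] s6 [_ [f fI fP]] vi vj E.
have [l li lj] := third i j.
have vw := fP (elt_v (side b (v i))) l.
have il : i != l by rewrite eq_sym.
have jl : j != l by rewrite eq_sym.
have := side_eq b s6 li vw; have := side_eq b' s6 lj vw.
rewrite !upd_eq !(upd_neq _ _ il) !(upd_neq _ _ jl) vi vj -E /= eqxx.
by move=> /(_ erefl erefl)/esym/eqP<- /(_ erefl erefl)/esym/eqP<-.
Qed.

End Preservation.

(** * Short products and isomorphisms of generated subgroups *)

(** The powers of [1 |: A] increase. Each step gains an element until one step gains none, and from
    there on the power contains the generated subgroup. *)
Lemma gen_sub_expg (gT : finGroupType) (A : {set gT}) m : #|gT| <= m ->
  <<A>>%g \subset ((1 |: A) ^+ m)%g.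
Proof.
set B := (1 |: A)%g; have B1 : 1%g \in B by rewrite setU11.
have incr n : (B ^+ n)%g \subset (B ^+ n.+1)%g by rewrite expgSr mulg_subl.
have closed n : (B ^+ n.+1 \subset B ^+ n)%g -> (<<A>> \subset B ^+ n)%g.
  rewrite expgSr => BB; apply/subsetP => x /gen_prodgP[l [c cA ->]].
  elim: l c cA => [|l IH] c cA.
    rewrite big_ord0; elim: (n) => [|n' IHn]; first by rewrite expg0 set11.
    exact: (subsetP (incr n')).
  rewrite big_ord_recr /=; apply: (subsetP BB); apply: mem_mulg.
    by apply: IH => i; apply: cA.
  by rewrite setU1r.
suff /(_ m)[//|ltm gTm] :
    forall n, (<<A>> \subset B ^+ n)%g \/ n < #|(B ^+ n)%g|.
  by have := leq_trans ltm (leq_trans (max_card _) gTm); rewrite ltnn.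
elim=> [|n [AB|ltn]].
- by right; rewrite expg0 cards1.
- by left; apply: subset_trans AB (incr n).
case: (boolP (B ^+ n.+1 \subset B ^+ n)%g) => [/closed AB|nBB].
  by left; apply: subset_trans AB (incr n).
right; apply: leq_ltn_trans ltn _; apply: proper_card.
by rewrite properE incr.
Qed.

Lemma gen_prod_fst (G H : finGroupType) (I : finType) (g : I -> G)
    (h : I -> H) :
  <<[set g i | i : I]>>%g = (fst @: <<[set (g i, h i) | i : I]>>)%g.
Proof.
set A := [set (g i, h i) | i : I].
have := morphim_gen (fst_morphism G H) (subsetT A).
rewrite !morphimEsub ?subsetT // => ->.
by rewrite -imset_comp.
Qed.

Lemma gen_prod_snd (G H : finGroupType) (I : finType) (g : I -> G)
    (h : I -> H) :
  <<[set h i | i : I]>>%g = (snd @: <<[set (g i, h i) | i : I]>>)%g.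
Proof.
set A := [set (g i, h i) | i : I].
have := morphim_gen (snd_morphism G H) (subsetT A).
rewrite !morphimEsub ?subsetT // => ->.
by rewrite -imset_comp.
Qed.

(** The subgroup of [G * H] generated by the pairs [(g i, h i)] projects onto both generated
    subgroups; lying in the graph of an injection, it is the graph of an isomorphism between
    them. *)
Lemma marked_iso_graph k (G H : finGroupType) (g : {ffun 'I_k -> G})
    (h : {ffun 'I_k -> H}) (phi : G -> H) : injective phi ->
  (forall x y, (x, y) \in <<[set (g i, h i) | i : 'I_k]>>%g -> phi x = y) ->
  marked_iso (ffun_tuple g) (ffun_tuple h).
Proof.
move=> phiI; set D := <<_>>%g => phiD.
have setE (K : finGroupType) (u : {ffun 'I_k -> K}) :
    [set x in ffun_tuple u] = [set u i | i : 'I_k].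
  apply/setP => x; rewrite inE; apply/tnthP/imsetP => [[i ->]|[i _ ->]].
    by exists i => //; rewrite tnth_mktuple.
  by exists i; rewrite tnth_mktuple.
have gE := gen_prod_fst g h; have hE := gen_prod_snd g h.
have phi1 : phi 1%g = 1%g by apply: phiD; apply: group1.
apply/existsP; exists (finfun phi); apply/andP; split; last first.
  apply/forallP => i; rewrite ffunE !tnth_mktuple; apply/eqP/phiD.
  by apply: mem_gen; apply: imset_f.
rewrite !setE gE hE; apply/andP; split.
  apply/morphicP => _ _ /imsetP[[x y] xy ->] /imsetP[[x' y'] xy' ->] /=.
  rewrite !ffunE (phiD _ _ xy) (phiD _ _ xy'); apply: phiD.
  by rewrite -[(_, _)]/((x, y) * (x', y'))%g groupM.
(* [misom] compares images without the identity, so nontrivial elements must have nontrivial images;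
   injectivity of [phi] ensures this. *)
apply/eqP/setP => z; apply/imsetP/setD1P.
  move=> [_ /setD1P[/[swap] /imsetP[[x y] xy /= ->] x1] ->].
  rewrite ffunE (phiD _ _ xy); split.
    apply: contraNneq x1 => y1; apply/eqP/phiI.
    by rewrite (phiD _ _ xy) phi1.
  by apply/imsetP; exists (x, y).
move=> [z1 /imsetP[[x y] xy /= zE]]; exists x; rewrite ?ffunE ?(phiD _ _ xy) //.
rewrite !inE; apply/andP; split; last by apply/imsetP; exists (x, y).
by apply: contraNneq z1 => x1; rewrite zE -(phiD _ _ xy) x1 phi1.
Qed.

(** * Grouping entries into pairs *)

Section Halves.

Variable k : nat.

Lemma src_subproof (j : 'I_(uphalf k)) (b : bool) : minn (j.*2 + b) k.-1 < k.
Proof. by have := ltn_ord j; case: b; lia. Qed.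

(* Entries [2j] and [2j+1] form the [j]-th pair; for odd [k] the last pair
   repeats the last entry. *)
Definition src (j : 'I_(uphalf k)) (b : bool) : 'I_k :=
  Ordinal (src_subproof j b).

Lemma hlf_subproof (i : 'I_k) : i./2 < uphalf k.
Proof. by have := ltn_ord i; lia. Qed.

Definition hlf (i : 'I_k) : 'I_(uphalf k) := Ordinal (hlf_subproof i).

Lemma src_hlf i : src (hlf i) (odd i) = i.
Proof. by apply: val_inj => /=; have := ltn_ord i; lia. Qed.

Lemma hlf_src j b : hlf (src j b) = j.
Proof. by apply: val_inj => /=; have := ltn_ord j; case: b; lia. Qed.

(** The parity of [src j b] can differ from [b] only in the last pair for odd [k], whose two entries
    coincide. *)
Lemma src_odd j b : src j (odd (src j b)) = src j b.
Proof. by rewrite -{1}(hlf_src j b) src_hlf. Qed.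

End Halves.

Lemma card_third (J : finType) : 2 < #|J| ->
  forall i j : J, exists2 l, l != i & l != j.
Proof.
move=> J3 i j; have : 0 < #|~: [set i; j]|.
  have := cardsC [set i; j]; rewrite cards2; case: (i != j); lia.
case/card_gt0P=> l; rewrite !inE negb_or => /andP[li lj].
by exists l.
Qed.

Lemma eltE (G : finGroupType) (z : gamma_vertex G) :
  vtype z = None -> z = elt_v (vfst z).
Proof. by case: z => [x|[[g h] i]]. Qed.

Lemma b_vE (G : finGroupType) (z : gamma_vertex G) :
  vtype z = tb -> z = b_v (side false z) (side true z).
Proof. by case: z => [x|[[g h] i]] //= [->]. Qed.

Lemma third_slot k (i j : 'I_(uphalf k) + bool) : 0 < k ->
  exists2 l : ('I_(uphalf k) + bool)%type, l != i & l != j.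
Proof.
move=> k0; apply: (@card_third ('I_(uphalf k) + bool)%type).
by rewrite card_sum card_ord card_bool; case: k k0 {i j} => //; lia.
Qed.

(** * Simulating Version II in Version III *)

Section Simulation.

Variables (k : nat) (G H : finGroupType).
Hypothesis k0 : 0 < k.
Hypothesis GH : #|G| = #|H|.
Hypothesis G1 : 1 < #|G|.

Local Notation J := ('I_(uphalf k) + bool)%type.
Local Notation s1 := (inr false : J).
Local Notation s2 := (inr true : J).
Local Notation sim :=
  (game (@same_graph_type J _ _ (@gamma_edge G) (@gamma_edge H))).

Let third i j := @third_slot k i j k0.

Definition codes (K : finGroupType) (g : {ffun 'I_k -> K})
    (v : {ffun J -> gamma_vertex K}) : Prop :=
  forall j, v (inl j) = b_v (g (src j false)) (g (src j true)).

Lemma codes_upd (K : finGroupType) (g : {ffun 'I_k -> K}) v b z :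
  codes g v -> codes g (upd v (inr b) z).
Proof. by move=> gv j; rewrite upd_neq. Qed.

Lemma sim_vtype s v w i : 4 <= s -> sim s v w -> vtype (v i) = vtype (w i).
Proof. by move=> s4; apply: (pres1_vtype third GH G1 _ s4). Qed.

Section Words.

Variables (g : {ffun 'I_k -> G}) (h : {ffun 'I_k -> H}).
Local Notation A := [set (g i, h i) | i : 'I_k].

(* Halving: if [x = x1 * x2] is wrongly answered, then so is one of the two
   halves of the gadget [b_v x1 x2]. *)
Lemma word_forced m v w x y : codes g v -> codes h w ->
  v s1 = elt_v x -> sim (2 * m + 7) v w ->
  (x, y) \in ((1 |: A) ^+ (2 ^ m))%g -> w s1 = elt_v y.
Proof.
elim: m v w x y => [|m IH] v w x y gv hw vx vw.
  have w1 : vtype (w s1) = None by rewrite -(sim_vtype s1 _ vw) ?vx.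
  rewrite expn0 expg1 => /setU1P[[x1 y1]|/imsetP[i _ [xi yi]]].
    (* In this gadget [x = 1] is both factors and the product, so its answer is idempotent, hence
       the identity. *)
    case: (game_answer vw) => f fI /(_ (b_v 1 1)%g s2) {}vw.
    have s12 : s1 != s2 by [].
    have := side_eq third GH G1 false (isT : 6 <= 6) s12 vw.
    have := side_eq third GH G1 true (isT : 6 <= 6) s12 vw.
    have := prod_eq third GH G1 (isT : 6 <= 6) s12 vw.
    rewrite !upd_eq !(upd_neq _ _ s12) vx x1 /= mulg1 !eqxx.
    move=> /(_ erefl erefl)/esym/eqP e1 /(_ erefl erefl)/esym/eqP e2.
    move=> /(_ erefl erefl)/esym/eqP e3; rewrite (eltE w1) y1; congr (elt_v _).
    by apply: (mulgI (vfst (w s1))); rewrite mulg1 [RHS]e1 -e2 -e3.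
  (* A generator is already a component of a pebbled pair, which fixes its answer. *)
  have := side_eq third GH G1 (odd i) (isT : 6 <= 7)
    (isT : s1 != inl (hlf i) :> J) vw.
  rewrite vx gv hw (eltE w1) /= => /(_ erefl erefl).
  have sideE (K : finGroupType) (u : {ffun 'I_k -> K}) :
      side (odd i) (b_v (u (src (hlf i) false)) (u (src (hlf i) true))) = u i.
    by rewrite -[in RHS](src_hlf i); case: (odd i).
  by rewrite !sideE xi yi eqxx => /esym/eqP->.
(* Splitting the word in [G * H] splits [x] and [y] simultaneously. *)
rewrite expnS mul2n -addnn expgnDr => /mulsgP[[x1 y1] [x2 y2] xy1 xy2 [xE yE]].
have e : 2 * m.+1 + 7 = (2 * m + 7).+2 by lia.
rewrite e in vw; have s12 : s1 != s2 by [].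
have w1 : vtype (w s1) = None by rewrite -(sim_vtype s1 _ vw) ?vx //; lia.
case: (game_answer vw) => f fI /(_ (b_v x1 x2) s2).
set v' := upd v s2 _; set w' := upd w s2 _ => {}vw.
have v2 : v' s2 = b_v x1 x2 by rewrite /v' upd_eq.
have := prod_eq third GH G1 _ s12 vw.
rewrite v2 /v' /w' !(upd_neq _ _ s12) -/w' vx /= xE eqxx.
have -> : 5 < (2 * m + 7).+1 by lia.
move=> /(_ isT erefl erefl)/esym/eqP wE.
have gv' : codes g v' by apply: codes_upd.
have hw' : codes h w' by apply: codes_upd.
clearbody v' w'.
(* While the gadget stays on [s2], pebble [s1] is reused for either half, whose answer the induction
   hypothesis forces. *)
have half b y0 : ((if b then x2 else x1), y0) \in ((1 |: A) ^+ (2 ^ m))%g ->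
    side b (w' s2) = y0.
  move=> xy0; have [f' _ f'P] := game_answer vw.
  have vw' := f'P (elt_v (if b then x2 else x1)) s1.
  have s21 : s2 != s1 by [].
  have := IH _ _ _ _ (codes_upd _ _ gv') (codes_upd _ _ hw')
    (upd_eq _ _ _) vw' xy0.
  have := side_eq third GH G1 b _ s12 vw'.
  rewrite !upd_eq !(upd_neq _ _ s21) v2 => + fE; rewrite fE.
  have -> : 5 < 2 * m + 7 by lia.
  by case: (b) => /(_ isT erefl erefl); rewrite /= eqxx => /esym/eqP->.
rewrite (eltE w1) wE -[vfst _]/(side false _) -[vsnd _]/(side true _).
by rewrite (half false y1) // (half true y2) // yE.
Qed.

(** One round asks for the answer to every element at once; this injection agrees with all words of
    length [2 ^ m] in the pairs [(g i, h i)], hence on the subgroup they generate. *)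
Lemma codes_marked_iso m v w : #|G| * #|H| <= 2 ^ m ->
  codes g v -> codes h w -> sim (2 * m + 8) v w ->
  marked_iso (ffun_tuple g) (ffun_tuple h).
Proof.
move=> GHm gv hw; rewrite addnS => /game_answer[f fI fP].
have fE x : f (elt_v x) = elt_v (vfst (f (elt_v x))).
  apply: eltE; have := sim_vtype s1 _ (fP (elt_v x) s1).
  by rewrite !upd_eq => <- //; lia.
apply: (@marked_iso_graph _ _ _ _ _ (fun x => vfst (f (elt_v x)))).
  by move=> x x' E; have := fE x; rewrite E -fE => /fI[].
move=> x y xy.
have := word_forced (codes_upd _ _ gv) (codes_upd _ _ hw)
  (upd_eq _ _ _) (fP (elt_v x) s1).
rewrite upd_eq => /(_ y) -> //.
by apply: (subsetP (gen_sub_expg _ _)) xy; rewrite card_prod.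
Qed.

End Words.

Lemma codes_game m t g h v w : #|G| * #|H| <= 2 ^ m ->
  codes g v -> codes h w -> sim (2 * t + (2 * m + 8)) v w ->
  game (same_init (@init2 k G H G) (@init2 k G H H)) t g h.
Proof.
move=> GHm; elim: t g h v w => [|t IH] g h v w gv hw.
  by move=> vw; apply/init2P; apply: codes_marked_iso vw.
set T := 2 * m + 8; have T7 : 7 <= 2 * t + T by rewrite /T; lia.
have -> : 2 * t.+1 + T = (2 * t + T).+2 by lia.
move=> vw; split; first by apply: (IH _ _ _ _ gv hw); apply: game_le vw; lia.
case: (game_answer vw) => f fI fP.
have fE x : f (elt_v x) = elt_v (vfst (f (elt_v x))).
  apply: eltE; have := sim_vtype s1 _ (fP (elt_v x) s1).
  by rewrite !upd_eq => <- //; lia.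
exists (fun x => vfst (f (elt_v x))).
  by move=> x x' E; have := fE x; rewrite E -fE => /fI[].
move=> x i; set y := vfst _; pose j := hlf i.
have := fP (elt_v x) s1; rewrite fE -/y.
set v1 := upd v s1 _; set w1 := upd w s1 _ => vw1.
pose g' := upd g i x; pose h' := upd h i y.
pose z := b_v (g' (src j false)) (g' (src j true)).
have [f1 _ /(_ z s2)] := game_answer vw1.
set v2 := upd v1 s2 _; set w2 := upd w1 s2 _ => vw2.
have v2s2 : v2 s2 = z by rewrite /v2 upd_eq.
have s12 : s1 != s2 by [].
have v2s1 : v2 s1 = elt_v x by rewrite /v2 upd_neq // /v1 upd_eq.
have w2s1 : w2 s1 = elt_v y by rewrite /w2 upd_neq // /w1 upd_eq.
have gv2 : codes g v2 by do 2!apply: codes_upd.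
have hw2 : codes h w2 by do 2!apply: codes_upd.
clearbody v2 w2.
have zt : vtype (w2 s2) = tb.
  by rewrite -(sim_vtype s2 _ vw2) ?v2s2 //; lia.
have sideE (K : finGroupType) (a b : K) c :
    side c (b_v a b) = if c then b else a by case: c.
have sz b : side b z = g' (src j b) by rewrite sideE; case: b.
(* A changed component is tied to the element on [s1], an unchanged one to the old pair, still
   pebbled at [inl j]. *)
have sw b : side b (w2 s2) = h' (src j b).
  rewrite /h' ffunE; case: eqP => [ji|/eqP ji].
    apply/esym/eqP; have := side_eq third GH G1 b _ s12 vw2.
    rewrite v2s1 w2s1 v2s2 sz /= /g' ffunE ji eqxx => <- //; lia.
  have -> : h (src j b) = side b (w2 (inl j)) by rewrite hw2 sideE; case: (b).
  apply: (side_shared third GH G1 T7 vw2); rewrite ?v2s2 ?gv2 //.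
  by rewrite sz sideE /g' ffunE (negPf ji); case: (b).
(* Only now does the new pair take the place of the old one. *)
pose sw12 := tperm s2 (inl j : J).
have swj : sw12 (inl j) = s2 by rewrite tpermR.
have swO j' : j' != j -> sw12 (inl j') = inl j'.
  by move=> jj; rewrite tpermD // eq_sym.
have src_j j' b : j' != j -> src j' b != i.
  by apply: contraNneq => /(congr1 (@hlf k)); rewrite hlf_src => ->.
apply: (IH _ _ (relabel sw12 v2) (relabel sw12 w2)).
- move=> j'; rewrite ffunE; case: (eqVneq j' j) => [->|jj].
    by rewrite swj v2s2.
  by rewrite swO // gv2 !upd_neq ?src_j.
- move=> j'; rewrite ffunE; case: (eqVneq j' j) => [->|jj].
    by rewrite swj (b_vE zt) !sw.
  by rewrite swO // hw2 !upd_neq ?src_j.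
apply: game_relabel vw2; first exact: perm_inj.
by move=> v' w' vw' a b; rewrite !ffunE.
Qed.

End Simulation.

(** * Passing between tuples and pebbled pairs *)

Section Pairing.

Variables (k : nat) (j0 : 'I_(uphalf k)).
Local Notation J := ('I_(uphalf k) + bool)%type.

Definition pair_slot (j : J) : 'I_(uphalf k) := if j is inl j' then j' else j0.

(** The two spare pebbles repeat pair [j0], so that they add no information to the answer. *)
Definition pairs (K : finGroupType) (g : {ffun 'I_k -> K}) :
    {ffun J -> gamma_vertex K} :=
  [ffun j => b_v (g (src (pair_slot j) false)) (g (src (pair_slot j) true))].

Definition unpairs (K : finGroupType) (v : {ffun J -> gamma_vertex K}) :
    {ffun 'I_k -> K} := [ffun i : 'I_k => side (odd i) (v (inl (hlf i)))].

Lemma pairsK (K : finGroupType) : cancel (@pairs K) (@unpairs K).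
Proof.
move=> g; apply/ffunP => i; rewrite !ffunE /=.
by rewrite -[in RHS](src_hlf i); case: (odd i).
Qed.

(** Duplicator preserves types, copies and shared components, so an answer to a coded tuple is again
    a coded tuple. This makes the answers to distinct tuples distinct. *)
Lemma unpairsK (G H : finGroupType) g (w : {ffun J -> gamma_vertex H}) s :
  #|G| = #|H| -> 1 < #|G| -> 7 <= s ->
  game (@same_graph_type J _ _ (@gamma_edge G) (@gamma_edge H)) s (pairs g) w ->
  pairs (unpairs w) = w.
Proof.
move=> GH G1 s7 gw.
have k0 : 0 < k by have := ltn_ord j0; lia.
have third i j := @third_slot k i j k0.
apply/ffunP => j; rewrite ffunE; set j' := pair_slot j.
have wt : vtype (w (inl j')) = tb.
  by rewrite -(sim_vtype k0 GH G1 (inl j') _ gw) ?ffunE //; lia.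
have -> : w j = w (inl j').
  have [_] := game_init gw j (inl j').
  by rewrite !ffunE eqxx => /esym/eqP.
have sE b : unpairs w (src j' b) = side b (w (inl j')).
  rewrite ffunE hlf_src; apply: (side_shared third GH G1 s7 gw).
  1,2: by rewrite ffunE.
  have gE c : side c (pairs g (inl j')) = g (src j' c).
    by rewrite ffunE; case: c.
  by rewrite !gE src_odd.
by rewrite (b_vE wt) !sE.
Qed.

End Pairing.

(** * Round counts and conclusion *)

Lemma WL2_WL3 (G H : finGroupType) k r : #|G| = #|H| -> 1 < #|G| ->
  0 < k -> 0 < r -> WL2_distinguishes k r G H ->
  WL3_distinguishes (uphalf k + 2) (3 * r + 12 * up_log 2 #|G|) G H.
Proof.
move=> GH G1 k0 r0; apply: contraLR => Hd.
pose J : finType := ('I_(uphalf k) + bool)%type.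
have L0 : 0 < up_log 2 #|G| by rewrite up_log_gt0.
have [||F FI FP] := @wl_equivalent_relabel _ J _ _ _ _ _
    (same_graph_type (@gamma_edge G) (@gamma_edge H)) _
    (card_gamma_vertex GH) _ _ Hd.
- by rewrite card_sum card_ord card_bool.
- by move=> s v w _ /same_init_graphP vw i j; rewrite !ffunE.
apply/(wl_distinguishesPn _ _ _ GH).
pose j0 := hlf (Ordinal k0).
have unK g : pairs j0 (unpairs (F (pairs j0 g))) = F (pairs j0 g).
  by apply: (unpairsK GH G1 _ (FP _)); lia.
exists (fun g => unpairs (F (pairs j0 g))).
  move=> g g' /(congr1 (@pairs _ j0 H)); rewrite !unK => /FI.
  exact: (can_inj (@pairsK _ j0 _)).
(* Words of length [#|G| * #|H|], the square of the order, are halved at most [2 * up_log 2 #|G|]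
   times. *)
move=> g; apply: (@codes_game _ _ _ k0 GH G1 (2 * up_log 2 #|G|) _ _ _
  (pairs j0 g) (F (pairs j0 g))).
- by rewrite -GH mul2n -addnn expnD leq_mul // up_logP.
- by move=> j; rewrite ffunE.
- by move=> j; rewrite -[in LHS]unK ffunE.
(* With [L] the logarithm, [2 * r.-1 + (4 * L + 8)] rounds suffice; [L0] lets multiples of [L]
   absorb the additive constant. *)
by apply: game_le (FP _); lia.
Qed.

(** For order one the logarithm vanishes and degrees no longer single out the elements, but all
    tuples are then equivalent. *)
Lemma trivial_WL2 (G H : finGroupType) k r : #|G| = 1 -> #|H| = 1 ->
  ~~ WL2_distinguishes k r G H.
Proof.
move=> cG cH; have [x0 Gx] := fintype1 cG; have [y0 Hy] := fintype1 cH.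
have GH : #|G| = #|H| by rewrite cG cH.
have R (v : {ffun 'I_k -> G}) (w : {ffun 'I_k -> H}) :
    same_init (@init2 k G H G) (@init2 k G H H) v w.
  apply/init2P; apply: (marked_iso_graph (phi := fun=> 1%g)).
    by move=> x y _; rewrite (Gx x) (Gx y).
  by move=> x y _; rewrite (Hy y) (Hy 1%g).
have all_game : forall t v w,
    game (same_init (@init2 k G H G) (@init2 k G H H)) t v w.
  elim=> [|t IH] v w; first exact: R.
  split=> //; exists (fun=> 1%g) => // x y _.
  by rewrite (Gx x) (Gx y).
apply/(wl_distinguishesPn _ _ _ GH); exists (fun=> [ffun=> 1%g]) => // v w _.
by apply/ffunP => i; rewrite (Gx (v i)) (Gx (w i)).
Qed.

(* The logarithm is ceil(log2 n); the base and the rounding are absorbed in c. *)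
Theorem mainTheorem10 :
  exists c : nat,
  forall (G H : finGroupType) (n k r : nat),
    #|G| = n -> #|H| = n -> 2 <= k -> 1 <= r ->
    [/\ (WL1_distinguishes k r G H -> WL2_distinguishes k r G H),
        (WL2_distinguishes k r G H ->
           WL3_distinguishes (uphalf k + 2) (3 * r + c * up_log 2 n) G H)
      & (WL3_distinguishes k r G H ->
           WL1_distinguishes (2 * k + 1) (2 * r) G H)].
Proof.
exists 12 => G H n k r Gn Hn k2 r0.
have GH : #|G| = #|H| by rewrite Gn Hn.
split; first exact: WL1_WL2.
  case: (ltnP 1 n) => n1; first by rewrite -Gn; apply: WL2_WL3 => //; lia.
  have G0 : 0 < #|G| by apply/card_gt0P; exists 1%g.
  by rewrite (negPf (trivial_WL2 k r _ _)) //; lia.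
by apply: WL3_WL1 => //; lia.
Qed.
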